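(* Let $\kappa$ be an infinite cardinal with $\kappa^{<\kappa}>\kappa$ (which holds in particular whenever $\kappa$ is singular). Then the space ${}^{<\kappa}\square\,2^\kappa$ is not $(<\kappa)$-compact; moreover, it has a cover of cardinality $\ge\kappa$ consisting of pairwise disjoint basic open sets.
   Context: $2=\{0,1\}$ is discrete. ${}^{<\kappa}\square\,2^\kappa$ is the set ${}^\kappa 2$ of functions $\kappa\to 2$ with the topology whose basic open (clopen) sets are $[s]=\{f\in{}^\kappa2:s\subseteq f\}$ for partial functions $s$ from $\kappa$ to $2$ with $|\mathrm{dom}(s)|<\kappa$. A space is $(<\kappa)$-compact if every open cover has a subcover of size $<\kappa$. *)

(* Defs.v *)
From HB Require Import structures.
From mathcomp Require Import all_boot.
From mathcomp Require Import boolp wochoice classical_sets functions cardinality.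
From mathcomp Require Import topology_structure.

Set Implicit Arguments.
Unset Strict Implicit.
Unset Printing Implicit Defensive.

Local Open Scope classical_set_scope.
Local Open Scope card_scope.

Definition card_lt (T U : Type) (A : set T) (B : set U) : Prop :=
  A #<= B /\ ~ (B #<= A).
Notation "A '#<' B" := (card_lt A B) (at level 79) : card_scope.

Definition seg (T : Type) (R : rel T) (a : T) : set T := [set x | ~~ R a x].

(* An infinite cardinal as an initial ordinal: a well-ordered infinite type
   ([ordle] is the non-strict order) whose proper initial segments are all strictly
   smaller in cardinality.  [card_sort k] is the set of ordinals below k, and
   [set: k] has cardinality k. *)
Record infinite_cardinal := InfiniteCardinal {
  card_sort :> Type ;
  ordle : rel card_sort ;
  ordle_wo : well_order ordle ;
  ordle_initial : forall a : card_sort, seg ordle a #< [set: card_sort] ;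
  card_infinite : infinite_set [set: card_sort]
}.

(* The ordinal a, as the set of ordinals below a. *)
Definition below (k : infinite_cardinal) (a : k) : set k := seg (@ordle k) a.

(* The set of all functions from some ordinal a < k to k; the cardinal
   k^{<k} is its cardinality. *)
Definition lt_seq (k : infinite_cardinal) : Type := {a : k & below a -> k}.

(* k is singular, i.e. cf(k) < k. *)
Definition singular (k : infinite_cardinal) : Prop :=
  exists A : set k, A #< [set: k] /\
    forall x : k, exists2 y, A y & ordle x y.

Definition dom (T U : Type) (s : T -> option U) : set T :=
  [set x | exists y, s x = Some y].

Section Cardinality.

Lemma card_leI (T U : Type) (A : set T) (B : set U) (f : T -> U) :
  set_fun A B f -> set_inj A f -> A #<= B.
Proof.
move=> fAB fI; have [g] : $|{injfun A >-> B}| by apply/injfunPex; exists f.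
exact: inj_card_le.
Qed.

Lemma card_leE (T U : Type) (A : set T) (B : set U) (u : U) :
  A #<= B -> exists2 f : T -> U, set_fun A B f & set_inj A f.
Proof.
elim/Ppointed: U => [U|U] in B u *; first by case: (no u).
by move/pcard_leP => [f]; exists f; [exact: funS | exact: inj].
Qed.

Lemma card_le_total (T U : Type) (A : set T) (B : set U) :
  A #<= B \/ B #<= A.
Proof.
pose P (G : set (T * U)) := G `<=` A `*` B /\
  forall p q, G p -> G q -> (p.1 = q.1 <-> p.2 = q.2).
have [F FP tF|G [[GAB Ginj] Gmax]] := @Zorn_bigcup _ P.
  split=> [p [X /FP[XAB _] /XAB]//|p q [X FX Xp] [Y FY Yq]].
  have [XY|YX] := tF _ _ FX FY.
    by apply: (FP _ FY).2 => //; exact: XY.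
  by apply: (FP _ FX).2 => //; exact: YX.
have [AG|] := pselect (forall a, A a -> exists b, G (a, b)).
  left; have [[a Aa]|A0] := pselect (A !=set0); last first.
    by rewrite (_ : A = set0) ?card_ge0//; apply: contrapT => /eqP/set0P.
  have [b0 _] := AG _ Aa.
  have /choice[f fG] : forall a, exists b, A a -> G (a, b).
    by move=> x; have [/AG[b ?]|?] := pselect (A x); [exists b | exists b0].
  apply: (@card_leI _ _ _ _ f) => [x /fG/GAB[]//|x y /set_mem/fG Gx /set_mem/fG Gy fxy].
  exact/(Ginj _ _ Gx Gy).
move=> /existsNP[a /not_implyP[Aa aG]].
have [BG|] := pselect (forall b, B b -> exists a, G (a, b)).
  right.
  have /choice[f fG] : forall b, exists a, B b -> G (a, b).
    by move=> x; have [/BG[b ?]|?] := pselect (B x); [exists b | exists a].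
  apply: (@card_leI _ _ _ _ f) => [x /fG/GAB[]//|x y /set_mem/fG Gx /set_mem/fG Gy fxy].
  exact/(Ginj _ _ Gx Gy).
move=> /existsNP[b /not_implyP[Bb bG]].
case: (Gmax (G `|` [set (a, b)])).
  split; first by move=> ? ?; left.
  by move=> /(_ (a, b)) /(_ (or_intror erefl)) Gab; apply: aG; exists b.
split=> [p [/GAB//|->//]|p q [Gp|->] [Gq|->]//=]; first exact: Ginj.
- split=> E; first by case: aG; exists p.2; rewrite -E -surjective_pairing.
  by case: bG; exists p.1; rewrite -E -surjective_pairing.
- split=> E; first by case: aG; exists q.2; rewrite E -surjective_pairing.
  by case: bG; exists q.1; rewrite E -surjective_pairing.
Qed.

Lemma countably_infinite_partition (T : Type) (A : set T) : infinite_set A ->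
  exists F : set (set T), [/\ trivIset F id, \bigcup_(X in F) X = A &
    forall X, F X -> X #= [set: nat]].
Proof.
move=> Ainf.
pose P (F : set (set T)) :=
  trivIset F id /\ forall X, F X -> X `<=` A /\ X #= [set: nat].
have [Z ZP tZ|F [[Ftriv FA] Fmax]] := @Zorn_bigcup _ P.
  split=> [X Y [F ZF FX] [G ZG GY]|X [F /ZP[_ FA] /FA]//].
  have [FG|GF] := tZ _ _ ZF ZG.
    by apply: (ZP _ ZG).1 => //; exact: FG.
  by apply: (ZP _ ZF).1 => //; exact: GF.
pose S := \bigcup_(X in F) X.
have SA : S `<=` A by move=> x [X /FA[XA _] /XA].
have Rfin : finite_set (A `\` S).
  apply: contrapT => /infiniteP Rinf.
  have /infinite_setN0[r0 _] : infinite_set (A `\` S) by exact/infiniteP.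
  have [f fR fI] := card_leE r0 Rinf.
  have fY : range f #= [set: nat].
    by apply: inj_card_eq => x y _ _; apply: fI; rewrite inE.
  have FfD : forall X, F X -> X `&` range f = set0.
    move=> X FX; apply/seteqP; split => // x [Xx [n _ fnx]].
    by have [_] := fR n I; rewrite fnx; apply; exists X.
  case: (Fmax (F `|` [set range f])).
    split; first by move=> ? ?; left.
    move=> /(_ (range f)) /(_ (or_intror erefl)) /FfD.
    rewrite setIid => /seteqP[/(_ (f 0)) + _]; apply.
    by exists 0.
  split=> [X Y [FX|->] [FY|->]//|X [/FA//|->]].
  - exact: Ftriv.
  - by move=> /set0P; rewrite FfD// eqxx.
  - by move=> /set0P; rewrite setIC FfD// eqxx.
  - by split=> // x [n _ <-]; have [] := fR n I.
have [[C FC]|F0] := pselect (exists C, F C); last first.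
  exfalso; apply: Ainf; rewrite (_ : A = A `\` S)// (_ : S = set0) ?setD0//.
  by apply/seteqP; split=> // x [X FX]; case: F0; exists X.
pose C' := C `|` (A `\` S).
have CS : C `<=` S by move=> x Cx; exists C.
exists ((F `\ C) `|` [set C']).
have dC X : (F `\ C) X -> X `&` C' = set0.
  move=> [FX XC]; apply/seteqP; split => // x [Xx [Cx|[_]]].
    by apply: XC; apply: Ftriv => //; exists x.
  by apply; exists X.
split.
- move=> X Y [FX|->] [FY|->]//.
  + by move=> ?; apply: Ftriv => //; [case: FX | case: FY].
  + by move=> /set0P; rewrite dC// eqxx.
  + by move=> /set0P; rewrite setIC dC// eqxx.
- apply/seteqP; split=> [x [X [[FX _] Xx|-> [/CS/SA//|[]//]]]|x Ax].
    by apply: SA; exists X.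
  have [[X FX Xx]|Sx] := pselect (S x); last by exists C' => //; [right | right].
  have [XC|XC] := pselect (X = C); first by exists C'; [right | left; rewrite -XC].
  by exists X => //; left.
- move=> X [[/FA[]//]|->].
  have [_ Ceq] := FA _ FC.
  apply: eq_card_nat.
    have -> : C' = \bigcup_(b in [set: bool]) if b then C else A `\` S.
      apply/seteqP; split=> [x [Cx|Rx]|x [[] _ xC]]; [|by exists false|by left|by right].
      by exists true.
    apply: bigcup_countable => // -[] _; first by rewrite (eq_countable Ceq).
    exact: finite_set_countable.
  apply: (@sub_infinite_set _ C); first by move=> ?; left.
  by rewrite (eq_finite_set Ceq); exact: infinite_nat.
Qed.

Lemma card_setX_bool (T : Type) (A : set T) :
  infinite_set A -> A `*` [set: bool] #<= A.
Proof.
move=> /countably_infinite_partition[F [Ftriv FA Fnat]].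
have /choice[C Cx] : forall x, exists C, A x -> F C /\ C x.
  move=> x; have [|?] := pselect (A x); last by exists set0.
  by rewrite -FA => -[X FX Xx]; exists X.
have /choice[e eP] : forall X, exists f : T -> nat,
    F X -> set_bij X [set: nat] f.
  move=> X; have [/Fnat|?] := pselect (F X); last by exists (fun=> 0).
  by move=> /pcard_eqP/bijPex[f fb]; exists f.
have Ffix X x : F X -> X x -> A x /\ C x = X.
  move=> FX Xx; have Ax : A x by rewrite -FA; exists X.
  by have [FC CCx] := Cx _ Ax; split=> //; apply: Ftriv => //; exists x.
have /choice[g gP] : forall p : T * bool, exists y, A p.1 ->
    C p.1 y /\ e (C p.1) y = (e (C p.1) p.1).*2 + p.2.
  move=> [x b]/=; have [/Cx[FC _]|?] := pselect (A x); last by exists x.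
  have [_ _ /(_ ((e (C x) x).*2 + b) I)[y Cy ey]] := eP _ FC.
  by exists y.
apply: (@card_leI _ _ _ _ g).
  by move=> p [/= Ap _]; have [Cg _] := gP _ Ap; have [/Ffix/(_ Cg)[]] := Cx _ Ap.
move=> [x b] [y c] /set_mem[/= Ax _] /set_mem[/= Ay _] gxy.
have [/= Cgx ex] := gP (x, b) Ax.
have [/= Cgy ey] := gP (y, c) Ay.
have [FCx CCx] := Cx _ Ax; have [FCy CCy] := Cx _ Ay.
have Cxy : C x = C y.
  by have [_ <-] := Ffix _ _ FCx Cgx; have [_ <-] := Ffix _ _ FCy Cgy; rewrite gxy.
have := ex; rewrite gxy Cxy ey => exy.
have bc : b = c.
  by have /(congr1 odd) := exy; rewrite !oddD !odd_double; case: (b); case: (c).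
move: exy; rewrite bc => /addIn/double_inj exy.
have [_ inj _] := eP _ FCy.
by congr pair; apply/esym; apply: inj => //; rewrite inE// -Cxy.
Qed.

Lemma infinite_cardinal_card_ltU (k : infinite_cardinal) (T : Type)
    (A B : set T) :
  A #< [set: k] -> B #< [set: k] -> A `|` B #< [set: k].
Proof.
wlog AB : A B / A #<= B.
  move=> W Ak Bk; have [AB|BA] := card_le_total A B; first exact: W.
  by rewrite setUC; exact: W.
move=> [Ak Ak'] [Bk Bk'].
suff K : ~ ([set: k] #<= A `|` B).
  by split=> //; have [|/K] := card_le_total (A `|` B) [set: k].
have [Bfin|Binf] := pselect (finite_set B).
  have Afin : finite_set A by exact: card_le_finite AB Bfin.
  move=> kAB; apply: (@card_infinite k).
  by apply: card_le_finite kAB _; rewrite finite_setU.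
move=> kAB; apply: Bk'; apply: card_le_trans kAB _.
apply: card_le_trans (card_setX_bool Binf).
have [b Bb] := infinite_setN0 Binf.
have [f fAB fI] := card_leE b AB.
apply: (@card_leI _ _ _ _ (fun x => if `[< B x >] then (x, true) else (f x, false))).
  move=> x; case: asboolP => [Bx _//|nBx [Ax|//]].
  by split => //=; exact: fAB.
move=> x y /set_mem xU /set_mem yU.
case: asboolP => Bx; case: asboolP => By // [E] //.
apply: fI => //; rewrite inE; first by case: xU.
by case: yU.
Qed.

End Cardinality.

(* The functions k -> 2, under a name of their own so as not to pick up the
   product topology. *)
Definition box (k : infinite_cardinal) : Type := k -> bool.

HB.instance Definition _ (k : infinite_cardinal) := Choice.on (box k).

Section BoxTopology.
Variable k : infinite_cardinal.

(* The basic set [s], for a partial function s from k to 2. *)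
Definition cone (s : k -> option bool) : set (box k) :=
  [set f | forall x b, s x = Some b -> f x = b].

Definition basic_open : set (set (box k)) :=
  [set cone s | s in [set s | dom s #< [set: k]]].

Let basic_cover : \bigcup_(U in basic_open) U = [set: box k].
Proof.
apply/seteqP; split=> // f _; exists (cone (fun=> None)) => //.
exists (fun=> None) => //=.
have -> : dom (fun _ : k => @None bool) = set0.
  by apply/seteqP; split=> // x [].
split; first exact: card_ge0.
by move=> /card_le0P k0; apply: (@card_infinite k); rewrite k0.
Qed.

Let basic_join (U V : set (box k)) (f : box k) :
  basic_open U -> basic_open V -> U f -> V f ->
  exists W, [/\ basic_open W, W f & W `<=` U `&` V].
Proof.
move=> [s sk <-] [t tk <-] sf tf.
pose u x := if s x is Some b then Some b else t x.
exists (cone u); split.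
- exists u => //=; rewrite (_ : dom u = dom s `|` dom t).
    exact: infinite_cardinal_card_ltU.
  rewrite /dom /u; apply/seteqP; split=> x /=.
    by case: (s x) => [b _|[b tb]]; [left; exists b | right; exists b].
  by move=> [[b ->]|[b tb]]; [exists b | case: (s x) => [c|]; [exists c | exists b]].
- move=> x b; rewrite /u; case E : (s x) => [c|]; last exact: tf.
  by move=> [<-]; exact: sf.
- move=> g gu; split=> x b sxb; first by apply: gu; rewrite /u sxb.
  case E : (s x) => [c|]; last by apply: gu; rewrite /u E.
  by rewrite (gu x c) /u ?E//; rewrite -(sf _ _ E) (tf _ _ sxb).
Qed.

HB.instance Definition _ := isBaseTopological.Build (box k)
  (I := set (box k)) (D := basic_open) (b := id) basic_cover basic_join.

End BoxTopology.
Arguments basic_open : clear implicits.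

Definition is_cover (T : Type) (C : set (set T)) : Prop :=
  \bigcup_(U in C) U = [set: T].

(* (<k)-compactness of a space X. *)
Definition lt_compact (k : infinite_cardinal) (X : topologicalType) : Prop :=
  forall C : set (set X), (forall U, C U -> open U) -> is_cover C ->
    exists D : set (set X), [/\ D `<=` C, D #< [set: k] & is_cover D].

(* Main.v *)
(* If A is cofinal in k with |A| < k, read f on A, let a be the first element of A
   with f a = 1, and then read f up to a.  Fewer than k coordinates are read, and
   the possible outcomes partition the space into basic open sets; writing a(x) for
   the first element of A above x, the indicators of the sets {x, a(x)} lie in
   distinct cells.  If k is regular and k^{<k} > k, some c < k has 2^|c| >= k:
   otherwise, since functions from ordinals below k to k are bounded, coding their
   graphs would give k^{<k} <= k.  Then restriction to c is the partition.  A cover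
   by disjoint nonempty sets has no proper subcover. *)
Require Import Defs.
From mathcomp Require Import all_boot.
From mathcomp Require Import boolp classical_sets functions cardinality.
From mathcomp Require Import topology_structure.

Set Implicit Arguments.
Unset Strict Implicit.
Unset Printing Implicit Defensive.

Local Open Scope classical_set_scope.
Local Open Scope card_scope.

(** * Cardinal arithmetic of products, squares and power sets *)

Lemma card_le_setX (T T' U U' : Type) (A : set T) (A' : set T') (B : set U)
    (B' : set U') :
  A #<= A' -> B #<= B' -> A `*` B #<= A' `*` B'.
Proof.
move=> AA BB; have [->|/set0P[[a b] [/= Aa Bb]]] := eqVneq (A `*` B) set0.
  exact: card_ge0.
have [a' _] : A' !=set0.
  by apply/set0P/eqP => A0; move: AA; rewrite A0 => /card_le0P A1; rewrite A1 in Aa.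
have [b' _] : B' !=set0.
  by apply/set0P/eqP => B0; move: BB; rewrite B0 => /card_le0P B1; rewrite B1 in Bb.
have [f fA fI] := card_leE a' AA; have [g gB gI] := card_leE b' BB.
apply: (@card_leI _ _ _ _ (fun p => (f p.1, g p.2))).
  by move=> p [/fA ? /gB ?].
move=> [x y] [z t] /set_mem[/= Ax By] /set_mem[/= Az Bt] [fxz gyt].
by congr pair; [apply: fI | apply: gI]; rewrite ?inE.
Qed.

(* In a maximal pairing (X, m), X is equinumerous with A: otherwise A \ X contains
   a copy Y of X, and m extends to X u Y, as (X u Y)^2 \ X^2, which is at most
   X * bool * bool, embeds in Y. *)
Section Pairing.
Variables (T : Type) (A : set T).

Definition is_pairing (p : set T * (T * T -> T)) : Prop :=
  [/\ infinite_set p.1, p.1 `<=` A, set_fun (p.1 `*` p.1) p.1 p.2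
    & set_inj (p.1 `*` p.1) p.2].

(** Values off the square of [p.1] are arbitrary and ignored, so this is only a preorder; hence
    [ZL_preorder] below. *)
Definition pairing_extends (p q : set T * (T * T -> T)) : Prop :=
  p.1 `<=` q.1 /\ {in p.1 `*` p.1, p.2 =1 q.2}.

(** The square of a countably infinite subset of [A] is countable; this starts the Zorn argument. *)
Lemma exists_pairing : infinite_set A -> exists p, is_pairing p.
Proof.
move=> Ainf; have [a _] := infinite_setN0 Ainf.
have [f fA fI] := card_leE a ((infiniteP A).1 Ainf).
have Cnat : range f #= [set: nat] by apply: inj_card_eq.
have Ccount : countable (range f) by rewrite (eq_countable Cnat).
have CC : range f `*` range f #<= range f.
  by apply: card_le_trans (countableX Ccount Ccount) _; rewrite (card_le_eqr Cnat).
have [m mC mI] := card_leE a CC.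
exists (range f, m); split=> //=.
  by rewrite (eq_finite_set Cnat); exact: infinite_nat.
by move=> _ [n _ <-]; exact: fA.
Qed.

Lemma pairing_extends_refl p : pairing_extends p p.
Proof. by split. Qed.

Lemma pairing_extends_trans q p r :
  pairing_extends p q -> pairing_extends q r -> pairing_extends p r.
Proof.
move=> [pq epq] [qr eqr]; split; first exact: subset_trans qr.
move=> z zp; rewrite epq//; apply: eqr.
by move: zp; rewrite !inE => -[/pq ? /pq ?].
Qed.

(** The maps agree where they overlap and glue on the union of the sets. In a chain, any pair from
    the union lies in the square of a single member. *)
Lemma pairing_chain_ub (F : set (set T * (T * T -> T))) :
  F !=set0 -> F `<=` is_pairing ->
  (forall p q, F p -> F q -> pairing_extends p q \/ pairing_extends q p) ->
  exists2 p, is_pairing p & forall q, F q -> pairing_extends q p.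
Proof.
move=> [p0 Fp0] FP Ftot.
have dir p q : F p -> F q -> exists r, [/\ F r, p.1 `<=` r.1 & q.1 `<=` r.1].
  move=> Fp Fq; have [[? _]|[? _]] := Ftot _ _ Fp Fq.
    by exists q; split=> //; exact: subset_refl.
  by exists p; split=> //; exact: subset_refl.
have /choice[m mP] : forall z, exists w, forall p, F p -> (p.1 `*` p.1) z -> p.2 z = w.
  move=> z; have [[p [Fp pz]]|noz] :=
    pselect (exists p, F p /\ (p.1 `*` p.1) z); last first.
    by exists z.1 => p Fp pz; case: noz; exists p.
  exists (p.2 z) => q Fq qz.
  by have [[_ E]|[_ E]] := Ftot _ _ Fp Fq; rewrite E// inE.
pose U := \bigcup_(p in F) p.1.
have dirU z : (U `*` U) z -> exists2 p, F p & (p.1 `*` p.1) z.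
  move=> [[p Fp pz] [q Fq qz]]; have [r [Fr pr qr]] := dir _ _ Fp Fq.
  by exists r => //; split; [exact: pr | exact: qr].
exists (U, m); last first.
  move=> q Fq; split=> [x qx|z]; first by exists q.
  by rewrite inE => qz; exact: mP.
split=> /=.
- apply: (@sub_infinite_set _ p0.1); last by case: (FP _ Fp0).
  by move=> x ?; exists p0.
- by move=> x [p /FP[_ pA _ _] /pA].
- move=> z /dirU[p Fp pz]; rewrite -(mP _ _ Fp pz); exists p => //.
  by have [_ _ + _] := FP _ Fp; apply.
- move=> z w /set_mem/dirU[p Fp pz] /set_mem/dirU[q Fq qw].
  have [r [Fr pr qr]] := dir _ _ Fp Fq.
  have rz : (r.1 `*` r.1) z by case: pz => /pr ? /pr.
  have rw : (r.1 `*` r.1) w by case: qw => /qr ? /qr.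
  rewrite -(mP _ _ Fr rz) -(mP _ _ Fr rw); have [_ _ _] := FP _ Fr.
  by apply; rewrite inE.
Qed.

Lemma pairing_proper_extension p :
  is_pairing p -> ~ (A #<= p.1) ->
  exists2 q, is_pairing q & pairing_extends p q /\ ~ (q.1 `<=` p.1).
Proof.
case: p => X m [/= Xinf XA mX mI] AX.
have [x0 Xx0] := infinite_setN0 Xinf.
have XB := card_setX_bool Xinf.
(* If [A \ X] embedded in [X], then [A] would embed in [X * bool], hence in [X]. *)
have XD : X #<= A `\` X.
  have [//|DX] := card_le_total X (A `\` X); case: AX.
  have [f fD fI] := card_leE x0 DX.
  apply: card_le_trans XB.
  apply: (@card_leI _ _ _ _ (fun x => if `[< X x >] then (x, true) else (f x, false))).
    move=> x Ax; case: asboolP => [//|nXx]; split=> //=; exact: fD.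
  move=> x y /set_mem Ax /set_mem Ay.
  by case: asboolP => Xx; case: asboolP => Xy // [] // /fI; apply; rewrite inE.
have [f fD fI] := card_leE x0 XD.
have [h hX hI] := card_leE x0 XB.
pose Y := f @` X.
have YA y : Y y -> A y by move=> [x /fD[]] ? _ <-.
have YX y : Y y -> ~ X y by move=> [x /fD[]] _ ? <-.
(* [g] folds [X u Y] onto [X]: the identity on [X], the inverse of [f] on [Y]. *)
have /choice[g gP] : forall z, exists x, (X z -> x = z) /\ (Y z -> X x /\ f x = z).
  move=> z; have [[x Xx fxz]|nYz] := pselect (Y z).
    by exists x; split=> // Xz; case: (YX z) => //; exists x.
  by exists z; split.
have gX z : (X `|` Y) z -> X (g z).
  by move=> [Xz|Yz]; [rewrite (gP z).1 | exact: (proj1 ((gP z).2 Yz))].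
have gI z w : (X `|` Y) z -> (X `|` Y) w -> g z = g w ->
    `[< X z >] = `[< X w >] -> z = w.
  move=> Uz Uw gzw; case: asboolP; case: asboolP => // Xw Xz _.
    by rewrite -((gP z).1 Xz) -((gP w).1 Xw).
  have Yz : Y z by case: Uz.
  have Yw : Y w by case: Uw.
  by rewrite -(proj2 ((gP z).2 Yz)) -(proj2 ((gP w).2 Yw)) gzw.
(* The two bits record which coordinates lie in [X], information lost under [g]. *)
pose code z := h (h (m (g z.1, g z.2), `[< X z.1 >]), `[< X z.2 >]).
have mg z : ((X `|` Y) `*` (X `|` Y)) z -> X (m (g z.1, g z.2)).
  by move=> [z1 z2]; apply: mX; split; exact: gX.
have hh x b : X x -> X (h (x, b)) by move=> Xx; exact: hX.
have hinj x y b c : X x -> X y -> h (x, b) = h (y, c) -> (x, b) = (y, c).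
  by move=> Xx Xy; apply: hI; rewrite inE.
have codeX z : ((X `|` Y) `*` (X `|` Y)) z -> X (code z).
  by move=> Uz; do 2!apply: (hh); exact: mg.
have codeI : set_inj ((X `|` Y) `*` (X `|` Y)) code.
  move=> [z z'] [w w'] /set_mem Uz /set_mem Uw.
  have Mz := mg _ Uz; have Mw := mg _ Uw.
  move=> /(hinj _ _ _ _ (hh _ _ Mz) (hh _ _ Mw))[E e'].
  have [{}E e] := hinj _ _ _ _ Mz Mw E.
  case: Uz Uw => [/= Uz Uz'] [/= Uw Uw'].
  have Gz : (g z, g z') \in X `*` X by rewrite inE; split; exact: gX.
  have Gw : (g w, g w') \in X `*` X by rewrite inE; split; exact: gX.
  have [gz gz'] := mI _ _ Gz Gw E.
  by congr pair; exact: gI.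
(* New pairs go into [Y], so their images avoid those under [m]. *)
pose m' z := if `[< (X `*` X) z >] then m z else f (code z).
exists (X `|` Y, m'); split=> /=.
- apply: sub_infinite_set Xinf; exact: subsetUl.
- by move=> x [/XA|/YA].
- move=> z Uz; rewrite /m'; case: asboolP => XXz; first by left; exact: mX.
  by right; exists (code z) => //; exact: codeX.
- move=> z w Uz' Uw'; have /set_mem Uz := Uz'; have /set_mem Uw := Uw'.
  rewrite /m'; case: asboolP => Xz; case: asboolP => Xw.
  + by apply: mI; rewrite inE.
  + by move=> E; have [_] := fD _ (codeX _ Uw); rewrite -E; case; exact: mX.
  + by move=> E; have [_] := fD _ (codeX _ Uz); rewrite E; case; exact: mX.
  + move=> /fI; rewrite !inE => /(_ (codeX _ Uz) (codeX _ Uw)).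
    exact: codeI.
- split; first exact: subsetUl.
  by move=> z; rewrite inE /m' /= => Xz; rewrite asboolT.
- move=> /(_ (f x0)) /(_ (or_intror _)) Xf.
  by case: (YX (f x0)); [exists x0 | apply: Xf; exists x0].
Qed.

End Pairing.

(** Hessenberg's theorem: Zorn's lemma gives a maximal pairing, whose set is as large as [A], so its
    injection transfers to [A]. *)
Lemma card_setX_self (T : Type) (A : set T) : infinite_set A -> A `*` A #<= A.
Proof.
move=> Ainf; have [p0 Pp0] := exists_pairing Ainf.
pose R (p q : {p | is_pairing A p}) := `[< pairing_extends (sval p) (sval q) >].
have [|||p pmax] := @ZL_preorder _ (exist _ _ Pp0) R.
- by move=> p; apply/asboolP; exact: pairing_extends_refl.
- move=> r p q /asboolP rp /asboolP pq; apply/asboolP.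
  exact: pairing_extends_trans pq.
- move=> F Ftot; have [[p Fp]|F0] := pselect (F !=set0); last first.
    by exists (exist _ _ Pp0) => s Fs; case: F0; exists s.
  have [||_ _ [q Fq <-] [r Fr <-]|q Pq Fq] := @pairing_chain_ub _ A [set sval p | p in F].
  + by exists (sval p), p.
  + by move=> _ [q _ <-]; exact: svalP.
  + by have [/asboolP|/asboolP] := Ftot _ _ Fq Fr; [left | right].
  + by exists (exist _ _ Pq) => s Fs; apply/asboolP/Fq; exists s.
have [_ XA mX mI] := svalP p.
have [AX|/(pairing_proper_extension (svalP p))[q Pq [pq qp]]] :=
  pselect (A #<= (sval p).1); last first.
  by have /asboolP[] := pmax (exist _ _ Pq) (asboolT pq).
apply: card_le_trans (card_le_setX AX AX) _.
apply: card_le_trans (subset_card_le XA); exact: card_leI mX mI.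
Qed.

Lemma card_le_lt_trans (T U V : Type) (A : set T) (B : set U) (C : set V) :
  A #<= B -> B #< C -> A #< C.
Proof.
move=> AB [BC CB]; split; first exact: card_le_trans BC.
by move=> CA; apply: CB; exact: card_le_trans AB.
Qed.

Lemma card_le_powerset (T U : Type) (A : set T) (B : set U) :
  A #<= B -> [set X | X `<=` A] #<= [set Y | Y `<=` B].
Proof.
move=> AB; have [A0|/set0P[a Aa]] := eqVneq A set0.
  apply: (@card_leI _ _ _ _ (fun=> set0)); first by move=> ? _ ?.
  move=> X Y /set_mem XA /set_mem YA _.
  by move: XA YA; rewrite /= A0 !subset0 => -> ->.
have [b _] : B !=set0.
  by apply/set0P/eqP => B0; move: AB; rewrite B0 => /card_le0P A0; rewrite A0 in Aa.
have [f fB fI] := card_leE b AB.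
apply: (@card_leI _ _ _ _ (fun X => f @` X)).
  by move=> X XA _ [x /XA/fB ? <-].
move=> X Y /set_mem XA /set_mem YA XY.
have sub (X' Y' : set T) : X' `<=` A -> Y' `<=` A -> f @` X' = f @` Y' -> X' `<=` Y'.
  move=> XA' YA' XY' x Xx; have : (f @` X') (f x) by exists x.
  rewrite XY' => -[y Yy /fI <-//]; rewrite inE; [exact: YA'|exact: XA'].
by apply/seteqP; split; apply: sub.
Qed.

Lemma countable_powerset (T : Type) (A : set T) :
  finite_set A -> countable [set X | X `<=` A].
Proof.
move=> [n An]; have [/card_le_powerset AI _] := (card_eqPle _ _).1 An.
apply: card_le_trans AI _.
apply: (@card_leI _ _ _ _
  (fun Y => pickle [ffun i : 'I_n => `[< Y (nat_of_ord i) >]])) => //.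
move=> X Y /set_mem XI /set_mem YI /(pcan_inj pickleK)/ffunP XY.
apply/seteqP; split=> i.
  move=> Xi; have := XY (Ordinal (XI _ Xi)); rewrite !ffunE/= asboolT//.
  by move=> /esym/asboolP.
by move=> Yi; have := XY (Ordinal (YI _ Yi)); rewrite !ffunE/= (asboolT Yi) => /asboolP.
Qed.

(** * The well-order of an infinite cardinal *)

Section InfiniteCardinal.
Variable k : infinite_cardinal.
Implicit Types (x y z a : k) (A B : set k).

Lemma finite_card_lt (T : Type) (B : set T) : finite_set B -> B #< [set: k].
Proof.
move=> Bfin; have kB : ~ ([set: k] #<= B).
  by move=> /card_le_finite/(_ Bfin); exact: card_infinite.
by split=> //; have [//|] := card_le_total B [set: k].
Qed.

Lemma ordle_least B :
  B !=set0 -> exists2 x, B x & forall y, B y -> ordle x y.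
Proof.
move=> [b Bb].
have [|x [[xB xmin] _]] := @ordle_wo k (fun x => `[< B x >]).
  by exists b; apply/asboolP.
exists x; first by move: xB => /asboolP.
by move=> y By; apply: xmin; apply/asboolP.
Qed.

Lemma ordle_total x y : ordle x y \/ ordle y x.
Proof.
have [|z [->|->] zmin] := @ordle_least [set x; y]; first by exists x; left.
- by left; apply: zmin; right.
- by right; apply: zmin; left.
Qed.

Lemma ordle_refl x : ordle x x.
Proof. by have [] := ordle_total x x. Qed.

(** Both points are minima of [{x, y}], and [well_order] makes minima unique. *)
Lemma ordle_anti x y : ordle x y -> ordle y x -> x = y.
Proof.
move=> xy yx.
have [|z [_ zmin]] := @ordle_wo k (fun z => `[< [set x; y] z >]).
  by exists x; apply/asboolP; left.
have zx : z = x.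
  apply: zmin; split; first by apply/asboolP; left.
  by move=> w /asboolP[->|->//]; exact: ordle_refl.
rewrite -zx; apply: zmin; split; first by apply/asboolP; right.
by move=> w /asboolP[->//|->]; exact: ordle_refl.
Qed.

Lemma ordle_trans y x z : ordle x y -> ordle y z -> ordle x z.
Proof.
move=> xy yz.
have [|m mE mmin] := @ordle_least [set m | [\/ m = x, m = y | m = z]].
  by exists x; constructor 1.
have mx : ordle m x by apply: mmin; constructor 1.
have my : ordle m y by apply: mmin; constructor 2.
have mz : ordle m z by apply: mmin; constructor 3.
case: mE => mE; rewrite {}mE in mx my mz => //.
- by rewrite (ordle_anti xy mx).
- by rewrite -(ordle_anti yz my).
Qed.

Definition upto a : set k := [set x | ordle x a].

Lemma upto_card_lt a : upto a #< [set: k].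
Proof.
apply: (@card_le_lt_trans _ _ _ _ (below a `|` [set a])).
  apply: subset_card_le => x xa; have [ax|/negP ax] := pselect (ordle a x).
    by right; exact: ordle_anti.
  by left.
apply: infinite_cardinal_card_ltU; first exact: ordle_initial.
exact/finite_card_lt/finite_set1.
Qed.

Lemma card_lt_notin (B : set k) : B #< [set: k] -> exists x, ~ B x.
Proof.
move=> [_ kB]; apply: contrapT => /forallNP BT; apply: kB.
by apply: subset_card_le => x _; apply: contrapT; exact: BT.
Qed.

(** * Cofinality, and the size of [k^{<k}] *)

Lemma cofinal_strict A : (forall x, exists2 y, A y & ordle x y) ->
  forall x, exists2 y, A y & below y x.
Proof.
(* [k] has no largest element: pass first to some [x'] strictly above [x]. *)
move=> Acof x; have [x' xx'] := card_lt_notin (upto_card_lt x).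
have [y Ay xy] := Acof x'; exists y => //; apply/negP => yx.
by apply: xx'; exact: ordle_trans yx.
Qed.

(** Lets König's argument index [A] within one ordinal. Otherwise every [below y] embeds in [A];
    sending [x] to some [y] of [A] above it, together with the place of [x] below [y], embeds [k] in
    [A * A], so [k] would be at most [|A|]. *)
Lemma cofinal_card_le_below A : A #< [set: k] ->
  (forall x, exists2 y, A y & ordle x y) -> exists a : k, A #<= below a.
Proof.
move=> [_ kA] Acof; apply: contrapT => /forallNP Ab.
have /choice[i iP] : forall y, exists f : k -> k,
    set_fun (below y) A f /\ set_inj (below y) f.
  move=> y; have [/Ab[]|yA] := card_le_total A (below y).
  by have [f fA fI] := card_leE y yA; exists f.
have /choice[y yP] : forall x, exists y, A y /\ below y x.
  by move=> x; have [y] := cofinal_strict Acof x; exists y.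
have kAA : [set: k] #<= A `*` A.
  apply: (@card_leI _ _ _ _ (fun x => (y x, i (y x) x))).
    move=> x _; have [Ay xy] := yP x; split=> //=; exact: (iP _).1.
  move=> x z _ _ [yxz]; have [_ xy] := yP x; have [_ zy] := yP z.
  by rewrite yxz; apply: (iP (y z)).2; rewrite inE -?yxz// yxz.
have [Afin|Ainf] := pselect (finite_set A).
  by apply: (@card_infinite k); apply: card_le_finite kAA _; exact: finite_setX.
by apply: kA; apply: card_le_trans kAA _; exact: card_setX_self.
Qed.

Lemma card_le_lt_seq : [set: k] #<= [set: lt_seq k].
Proof.
apply: (@card_leI _ _ _ _ (fun x => existT _ x (fun=> x) : lt_seq k)) => //.
by move=> x y _ _ /(congr1 (@projT1 _ _)).
Qed.

(* König: if functions were coded by elements of k, pick for each y in a cofinal A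
   a value not taken at (the index of) y by any function with code at most y;
   the resulting function has no code. *)
Lemma singular_card_lt_seq : singular k -> [set: k] #< [set: lt_seq k].
Proof.
move=> [A [Ak Acof]]; split; first exact: card_le_lt_seq.
have [a /(card_leE a)[j ja jI]] := cofinal_card_le_below Ak Acof.
move=> /(card_leE a)[g _ gI].
have /choice[s sP] : forall x, exists p, (exists q, g q = x) -> g p = x.
  move=> x; have [[q <-]|nx] := pselect (exists q, g q = x); first by exists q.
  by exists (existT _ x (fun=> x)).
have sg p : s (g p) = p by apply: gI; rewrite ?inE// sP//; exists p.
(* [F p] extends [p] to all of [k], so that functions with different domains can be evaluated at the
   same point. *)
have /choice[F FP] : forall p : lt_seq k, exists F : k -> k,
    forall h : below (projT1 p), F (val h) = projT2 p h.
  move=> [b f]/=.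
  have /choice[F FE] : forall z, exists w, forall h : below b, val h = z -> f h = w.
    move=> z; have [[h hz]|nz] := pselect (exists h : below b, val h = z).
      by exists (f h) => h' h'z; congr f; apply: val_inj; rewrite hz.
    by exists z => h hz; case: nz; exists h.
  by exists F => h; apply/esym/FE.
(* Fewer than [k] codes are at most [y], so some value is left over. *)
have /choice[d dP] : forall y, exists w, forall x, ordle x y -> F (s x) (j y) <> w.
  move=> y; have [w wP] := card_lt_notin (card_le_lt_trans
    (card_image_le (fun x => F (s x) (j y)) (upto y)) (upto_card_lt y)).
  by exists w => x xy E; apply: wP; exists x.
have /choice[i iP] : forall z, exists y, A y /\ j y = z \/ ~ (exists y, A y /\ j y = z).
  move=> z; have [[y yP]|ny] := pselect (exists y, A y /\ j y = z).
    by exists y; left.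
  by exists z; right.
have ij y : A y -> i (j y) = y.
  move=> Ay; have [[Ai ji]|[]] := iP (j y); last by exists y.
  by apply: jI; rewrite ?inE.
pose p : lt_seq k := existT _ a (fun h : below a => d (i (val h))).
(* The code of [p] is at most some [y] in [A], so the value of [p] at [j y] would differ from
   itself. *)
have [y Ay py] := Acof (g p).
apply: (dP y (g p) py); rewrite sg.
by rewrite (FP p (SigSub (mem_set (ja _ Ay)))) /= ij.
Qed.

(** The range has at most [|a| < k] elements, so regularity keeps it from being cofinal. *)
Lemma not_singular_bounded a (f : below a -> k) : ~ singular k ->
  exists b : k, forall h, below b (f h).
Proof.
move=> /forallNP/(_ (range f))/not_andP[[]|/existsNP[b bP]].
  apply: card_le_lt_trans (ordle_initial a).
  by apply: card_le_trans (card_image_le _ _) _; rewrite (card_le_eql (card_setT _)).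
by exists b => h; apply/negP => bf; apply: bP; exists (f h) => //; exists h.
Qed.

(** If one factor is infinite, the larger absorbs the product; if both are finite, the power set is
    countable. *)
Lemma card_powerset_below_setX (a b : k) :
  (forall c : k, [set X | X `<=` below c] #<= [set: k]) ->
  [set X | X `<=` below a `*` below b] #<= [set: k].
Proof.
move=> Pk.
have sq (c : k) : infinite_set (below c) -> below a #<= below c -> below b #<= below c ->
    [set X | X `<=` below a `*` below b] #<= [set: k].
  move=> cinf ac bc; apply: card_le_trans (card_le_powerset _) (Pk c).
  apply: card_le_trans (card_le_setX ac bc) _; exact: card_setX_self.
have [[afin bfin]|/not_andP inf] :=
  pselect (finite_set (below a) /\ finite_set (below b)).
  apply: card_le_trans (countable_powerset (finite_setX afin bfin)) _.
  exact/infiniteP/card_infinite.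
have [ab|ba] := card_le_total (below a) (below b).
  apply: (sq b) => //; case: inf => // ainf bfin; apply: ainf.
  exact: card_le_finite ab bfin.
apply: (sq a) => //; case: inf => // binf afin; apply: binf.
exact: card_le_finite ba afin.
Qed.

(* A bounded function from below a to k is coded by its graph, a subset of
   below a * below b. *)
Lemma not_singular_card_lt_seq : ~ singular k ->
  (forall c : k, [set X | X `<=` below c] #<= [set: k]) ->
  [set: lt_seq k] #<= [set: k].
Proof.
move=> kreg Pk; have [k0 _] := infinite_setN0 (@card_infinite k).
have /choice[b bP] : forall p : lt_seq k, exists b : k,
    forall h, below b (projT2 p h).
  by move=> [a f]; exact: not_singular_bounded.
have /choice[c cP] : forall ab : k * k, exists f : set (k * k) -> k,
    set_inj [set X | X `<=` below ab.1 `*` below ab.2] f.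
  move=> [a b']; have [f _ fI] := card_leE k0 (card_powerset_below_setX a b' Pk).
  by exists f.
pose G (p : lt_seq k) := [set (val h, projT2 p h) | h in [set: below (projT1 p)]].
have GP p : G p `<=` below (projT1 p) `*` below (b p).
  move=> _ [h _ <-]; split=> /=; last exact: bP.
  exact: set_valP.
have kk := card_setX_self (@card_infinite k).
suff : [set: lt_seq k] #<= ([set: k] `*` [set: k]) `*` [set: k].
  move=> K; apply: card_le_trans K (card_le_trans (card_le_setX kk (card_lexx _)) kk).
(* The code consists of domain, bound and code of the graph; [c] depends only on the first two, so
   once these agree its injectivity applies. *)
apply: (@card_leI _ _ _ _ (fun p => ((projT1 p, b p), c (projT1 p, b p) (G p)))) => //.
move=> p q _ _ [pq bpq]; rewrite -pq -bpq => /cP; rewrite !inE.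
move=> /(_ (GP p)); have := GP q; rewrite -pq -bpq => Gq /(_ Gq).
case: p q pq {bpq Gq} => [a f] [a' g] /= aa'; rewrite -{}aa' in g *.
rewrite /G /= => fg; congr existT; apply/funext => h.
have : [set (val h, f h) | h in [set: below a]] (val h, f h) by exists h.
by rewrite fg => -[h' _ [/val_inj -> ->]].
Qed.

(** * Partitions of the space into basic open sets *)

Definition restr (D : set k) (f : box k) : k -> option bool :=
  fun x => if `[< D x >] then Some (f x) else None.

Lemma cone_restr (D : set k) (f g : box k) :
  cone (restr D f) g <-> {in D, f =1 g}.
Proof.
split=> [fg x /set_mem Dx|fg x b].
  by rewrite (fg x (f x))// /restr asboolT.
by rewrite /restr; case: asboolP => // Dx [<-]; rewrite fg ?inE.
Qed.

Lemma dom_restr (D : set k) (f : box k) : dom (restr D f) = D.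
Proof.
apply/seteqP; split=> [x [b]|x Dx]; first by rewrite /restr; case: asboolP.
by exists (f x); rewrite /restr asboolT.
Qed.

(* D f is the set of coordinates read by a decision procedure run on f; the
   cells are the sets of f on which the run is the same. *)
Lemma decision_partition (D : box k -> set k) (e : k -> box k) :
  (forall f, D f #< [set: k]) ->
  (forall f g, {in D f, f =1 g} -> D g = D f) ->
  (forall x y, {in D (e x), e x =1 e y} -> x = y) ->
  exists C : set (set (box k)),
    [/\ C `<=` basic_open k, is_cover C, trivIset C id & [set: k] #<= C].
Proof.
move=> Dk Dloc eI; pose cell f := cone (restr (D f) f).
have cell_refl f : cell f f by apply/cone_restr.
(* The run on any member of the cell of [f] repeats the run on [f], so cells that meet are equal. *)
have cellE f g : cell f g -> cell g = cell f.
  move=> /cone_restr fg; have Dg := Dloc _ _ fg; congr cone.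
  by apply/funext => x; rewrite /restr Dg; case: asboolP => // Dx; rewrite fg ?inE.
exists (range cell); split.
- by move=> _ [f _ <-]; exists (restr (D f) f) => //=; rewrite dom_restr.
- by apply/seteqP; split=> // f _; exists (cell f) => //; exists f.
- by move=> _ _ [f _ <-] [g _ <-] [h [/cellE <- /cellE <-]].
- apply: (@card_leI _ _ _ _ (cell \o e)); first by move=> x _; exists (e x).
  move=> x y _ _ /= exy; apply: eI; apply/cone_restr.
  by rewrite -[cone _]/(cell (e x)) exy.
Qed.

Lemma singular_partition : singular k ->
  exists C : set (set (box k)),
    [/\ C `<=` basic_open k, is_cover C, trivIset C id & [set: k] #<= C].
Proof.
move=> [A [Ak Acof]].
pose first (f : box k) a := [/\ A a, f a & forall b, A b -> f b -> ordle a b].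
(* If [f] vanishes on [A], there is no first element and only [A] is read. *)
pose D f := A `|` [set y | exists2 a, first f a & ordle y a].
have /choice[a aP] : forall x, exists a, [/\ A a, ordle x a &
    forall b, A b -> ordle x b -> ordle a b].
  move=> x; have [|a [Aa xa] amin] := @ordle_least (A `&` [set b | ordle x b]).
    by have [y Ay xy] := Acof x; exists y.
  by exists a; split=> // b Ab xb; exact: amin.
have aA x : A x -> a x = x.
  move=> Ax; have [_ xa /(_ _ Ax (ordle_refl x)) ax] := aP x.
  exact: ordle_anti.
pose e x : box k := fun z => `[< z = x \/ z = a x >].
have Dloc f g : {in D f, f =1 g} -> D g = D f.
  move=> fg; have fgA z : A z -> f z = g z by move=> Az; apply: fg; rewrite inE; left.
  congr (_ `|` _); apply/seteqP; split=> y [b [Ab fb bmin] yb]; exists b => //.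
    by split=> // [|c Ac fc]; [rewrite fgA | apply: bmin; rewrite // -fgA].
  by split=> // [|c Ac fc]; [rewrite -fgA | apply: bmin; rewrite // fgA].
(* On [e x] the first element of [A] with value 1 is [a x], so the run reads up to [a x] and meets
   [x]. *)
have De x : D (e x) x.
  have [Aa xa amin] := aP x; right; exists (a x) => //; split=> //.
    by apply/asboolP; right.
  move=> b Ab /asboolP[bx|->]; last exact: ordle_refl.
  by rewrite -bx aA ?bx; [exact: ordle_refl | rewrite -bx].
apply: (@decision_partition D e) => // [f|x y exy].
  apply: infinite_cardinal_card_ltU => //.
  have [[b bf]|nb] := pselect (exists b, first f b).
    apply: card_le_lt_trans (upto_card_lt b); apply: subset_card_le.
    move=> y [c [Ac fc cmin] yc]; have [Ab fb bmin] := bf.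
    by rewrite (@ordle_anti b c)//; [exact: bmin | exact: cmin].
  apply: finite_card_lt; rewrite (_ : mkset _ = set0)//.
  by apply/seteqP; split=> // y [c cf]; case: nb; exists c.
have exE z : D (e x) z -> e x z = e y z by move=> Dz; apply: exy; rewrite inE.
(* The coordinate [x] is read, so [e y] is 1 at [x]; symmetrically for [y]. *)
have xE : x = y \/ x = a y.
  by apply/asboolP; rewrite -[`[< _ >]]/(e y x) -exE//; apply/asboolP; left.
have yE : y = x \/ y = a x.
  apply/asboolP; rewrite -[`[< _ >]]/(e x y) exE; first by apply/asboolP; left.
  by rewrite -(Dloc _ _ exy).
(* In the crossed case [x = a y] lies in [A], hence [y = a x = x]. *)
case: xE => // xa; case: yE => // ya.
by have [Aay _ _] := aP y; rewrite [RHS]ya aA// xa.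
Qed.

(** The coordinates below [c] are read whatever the function is; indicators of distinct subsets of
    [below c] lie in distinct cells. *)
Lemma powerset_partition (c : k) : [set: k] #<= [set X | X `<=` below c] ->
  exists C : set (set (box k)),
    [/\ C `<=` basic_open k, is_cover C, trivIset C id & [set: k] #<= C].
Proof.
move=> /(card_leE set0)[h hc hI].
apply: (@decision_partition (fun=> below c) (fun x z => `[< h x z >])) => //.
  by move=> _; exact: ordle_initial.
move=> x y xy; apply: hI; rewrite ?inE//; apply/seteqP; split=> z hz.
  have := xy z; rewrite inE asboolT// => /(_ (hc _ I _ hz)).
  by move=> /esym/asboolP.
by have := xy z; rewrite inE (asboolT hz) => /(_ (hc _ I _ hz))/asboolP.
Qed.

Lemma basic_open_open (U : set (box k)) : basic_open k U -> open U.
Proof.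
move=> Ub; exists [set U]; first by move=> _ ->.
exact: bigcup_set1.
Qed.

Lemma cone_neq0 (s : k -> option bool) : cone s !=set0.
Proof.
by exists (fun x => if s x is Some b then b else false) => x b ->.
Qed.

(** A point of a member [U] of [C] lies in some member of the subcover, which disjointness
    identifies with [U]; so the subcover is all of [C]. *)
Lemma partition_not_lt_compact (C : set (set (box k))) :
  C `<=` basic_open k -> is_cover C -> trivIset C id -> [set: k] #<= C ->
  ~ lt_compact k (box k).
Proof.
move=> Cb Ccov Ctriv kC /(_ C (fun U CU => basic_open_open (Cb U CU)) Ccov).
move=> [D [DC [_ kD] Dcov]]; apply: kD; apply: card_le_trans kC _.
apply: subset_card_le => U CU; have [s _ sU] := Cb _ CU.
have [f sf] := cone_neq0 s; have : [set: box k] f by [].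
rewrite -Dcov => -[V DV Vf]; rewrite (_ : U = V)//.
by apply: Ctriv => //; [exact: DC | exists f; split=> //; rewrite -sU].
Qed.
End InfiniteCardinal.

Theorem theorem7p1 (k : infinite_cardinal) :
  (singular k -> [set: k] #< [set: lt_seq k]) /\
  ([set: k] #< [set: lt_seq k] ->
    ~ lt_compact k (box k) /\
    exists C : set (set (box k)),
      [/\ C `<=` basic_open k, is_cover C, trivIset C id & [set: k] #<= C]).
Proof.
split=> [|[_ seqk]]; first exact: singular_card_lt_seq.
have [C CP] : exists C : set (set (box k)),
    [/\ C `<=` basic_open k, is_cover C, trivIset C id & [set: k] #<= C].
  have [ksing|kreg] := pselect (singular k); first exact: singular_partition.
  have [[c]|nc] := pselect (exists c : k, [set: k] #<= [set X | X `<=` below c]).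
    exact: powerset_partition.
  (* Comparability turns the absence of such a [c] into a bound on every power set, contradicting
     [k^{<k} > k]. *)
  case: seqk; apply: not_singular_card_lt_seq => // c.
  by have [//|kc] := card_le_total [set X | X `<=` below c] [set: k]; case: nc; exists c.
split; last by exists C.
by case: CP; exact: partition_not_lt_compact.
Qed.
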